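(* Let $a<b$ be real numbers, let $M_0=1, M_1, M_2,\ldots$ be a sequence of positive real numbers, let $f\in C^\infty([a,b])$ be real-valued, and let $\{d_n\}_{n\in\mathbb{N}}$ be an increasing divergent sequence of positive integers. Put $F_n=\max_{x\in[a,b]}|f^{(n)}(x)|$ for $n\in\mathbb{N}$. Assume that: 1. (log-convexity) for all $j,\ell,k\in\mathbb{N}$ with $j<\ell<k$, $$M_\ell\le M_j^{\frac{k-\ell}{k-j}}\,M_k^{\frac{\ell-j}{k-j}};$$ 2. there exists $m_0\ge 0$ such that $$M_j\le M_k^{\frac jk}\,M_i^{\frac ji}$$ for all integers $i,j,k$ with $i,k>m_0$, $i<j$ and $j/i<k$; 3. there exists $c>0$ such that $M_n\ge c^n n^n$ for all $n$; 4. there exists $K>0$ such that $F_{d_n}\le K^{d_n+1}M_{d_n}$ for every $n\in\mathbb{N}$; 5. there exists $c_0>0$ such that $d_{n+1}/d_n\le c_0$ for every $n\in\mathbb{N}$. Then $f\in C^M([a,b])$.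
   Context: $\mathbb{N}$ denotes the set of non-negative integers. $C^\infty([a,b])$ is the set of smooth functions on the closed interval $[a,b]$. For a sequence $M=\{M_n\}_{n\in\mathbb{N}}$ of positive numbers, the Denjoy-Carleman class is $$C^M([a,b])=\{f\in C^\infty([a,b]) : \exists K>0 \text{ such that } |f^{(n)}(x)|\le K^{n+1}M_n \text{ for all } x\in[a,b],\ n=0,1,2,\ldots\}.$$ *)

(* Defs.v *)
From HB Require Import structures.
From mathcomp Require Import all_boot all_order all_algebra.
From mathcomp Require Import all_classical all_reals all_analysis.

Set Implicit Arguments.
Unset Strict Implicit.
Unset Printing Implicit Defensive.

Import Order.TTheory GRing.Theory Num.Theory.
Import numFieldNormedType.Exports.

Local Open Scope classical_set_scope.
Local Open Scope ring_scope.

(* Functions on [a, b] are represented by total functions R -> R whose values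
   outside [a, b] are irrelevant: all derivatives are taken relative to [a, b],
   hence are one-sided at the endpoints. *)

Definition diff_quotient (R : realType) (f : R -> R) (x y : R) : R :=
  (f y - f x) / (y - x).

Definition derivable_within (R : realType) (A : set R) (f : R -> R) (x : R) :
    Prop :=
  cvg (diff_quotient f x y @[y --> within A x^']).

(* Meaningful only when [derivable_within A f x] holds and [x] is a limit point
   of [A]. *)
Definition derive_within (R : realType) (A : set R) (f : R -> R) (x : R) : R :=
  lim (diff_quotient f x y @[y --> within A x^']).

Definition deriven_within (R : realType) (A : set R) (n : nat) (f : R -> R) :
    R -> R :=
  iter n (derive_within A) f.

(* Continuity of each derivative relative to [A] is automatic, as it is itself
   differentiable relative to [A]. *)
Definition smooth_within (R : realType) (A : set R) : set (R -> R) :=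
  [set f | forall (n : nat) (x : R), A x ->
             derivable_within A (deriven_within A n f) x].

Definition denjoy_carleman (R : realType) (M : nat -> R) (a b : R) :
    set (R -> R) :=
  [set f | smooth_within `[a, b]%classic f /\
           exists2 K : R, 0 < K &
             forall (x : R) (n : nat), x \in `[a, b] ->
               `|deriven_within `[a, b]%classic n f x| <= K ^+ n.+1 * M n].

Definition is_maximum (R : realType) (A : set R) (m : R) : Prop :=
  A m /\ ubound A m.

(* Main.v *)
(* Let p = d_i <= n < q = d_(i+1).  A Taylor expansion of f^(p) of order q - p,
   sampled at equidistant nodes of step t and combined with a crude Markov
   inequality (bounding the coefficients of a polynomial by its values at
   0, 1, ..., via Lagrange interpolation), gives the Gorny-type estimate
     t^(n-p) |f^(n)| <= C^q (F_p + t^(q-p) F_q)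
   for every t with 2 (q - p) t <= b - a.  Put mu = M_n^(1/n).  Log-convexity
   with M_0 = 1 gives M_p <= mu^p; the second hypothesis, with k a fixed integer
   larger than c_0, gives M_q <= (nu mu)^q.  The choice t = tau / mu makes both
   terms at most C^n M_n up to the factor t^(n-p), and it is admissible for a
   suitable constant tau because mu >= c n. *)

Require Import Defs.
From HB Require Import structures.
From mathcomp Require Import all_boot all_order all_algebra.
From mathcomp Require Import all_classical all_reals all_analysis.
From mathcomp Require Import ring lra.

Import Order.TTheory GRing.Theory Num.Theory.
Import numFieldNormedType.Exports.

Local Open Scope classical_set_scope.
Local Open Scope ring_scope.

(** * Calculus relative to [[a, b]] and the Taylor estimate *)

(** Continuity on the closed interval and two-sided derivatives in the open one are what Rolle's
    theorem takes; one-sided derivatives at the endpoints do not have to be handled again. *)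
Definition derives_on {R : realType} (a b : R) (f g : R -> R) : Prop :=
  {within `[a, b], continuous f} /\
  forall x, x \in `]a, b[ -> is_derive x 1 f (g x).

(** Caratheodory's form of differentiability: the difference quotient, given the derivative as its
    value at [x], is continuous at [x] relative to [A]. It yields both continuity of [f] and, at
    interior points, the usual derivative. *)
Lemma derivable_within_caratheodory {R : realType} (A : set R) (f : R -> R)
    (x : R) : derivable_within A f x ->
  exists2 g : R -> R, forall z, f z - f x = g z * (z - x) &
    g x = derive_within A f x /\ g @ within A (nbhs x) --> g x.
Proof.
move=> cvf; set l := derive_within A f x.
pose g z := if z == x then l else diff_quotient f x z.
have gx : g x = l by rewrite /g eqxx.
exists g.
  move=> z; rewrite /g; case: eqVneq => [->|zx]; first by rewrite !subrr mulr0.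
  by rewrite /diff_quotient divfK // subr_eq0.
split=> //; rewrite gx => W Wl; have Wl' := nbhs_singleton Wl.
have near_x : nbhs x [set y | y != x -> A y -> W (diff_quotient f x y)].
  exact: cvf W Wl.
suff : nbhs x [set y | A y -> W (g y)] by [].
apply: filterS near_x => y Wy Ay; rewrite /= /g.
by case: eqVneq => [_|yx]; [exact: Wl'|exact: Wy].
Qed.

Lemma derives_on_derive_within {R : realType} (a b : R) (f : R -> R) :
  (forall x, `[a, b]%classic x -> derivable_within `[a, b]%classic f x) ->
  derives_on a b f (derive_within `[a, b]%classic f).
Proof.
move=> df; split.
  apply/subspace_continuousP => x /df /derivable_within_caratheodory.
  case=> g fE [_ cvg].
  rewrite (_ : f = fun z => f x + g z * (z - x)); last first.
    by apply/funext => z; rewrite -fE addrC subrK.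
  rewrite [X in _ --> X](_ : _ = f x + g x * (x - x)) //.
  apply: cvgD; first exact: cvg_cst.
  apply: cvgM => //; apply: cvgB; last exact: cvg_cst.
  exact: cvg_within.
move=> x xab; apply/is_derive1_caratheodory.
have xab' : `[a, b]%classic x by exact: subset_itv_oo_cc.
have [g fE [gx cvg]] := derivable_within_caratheodory _ _ _ (df x xab').
exists g; split=> //.
(* At an interior point, neighbourhoods relative to [[a, b]] are ordinary neighbourhoods. *)
by move: cvg; rewrite within_interior ?interior_itv.
Qed.

(* Applying Rolle's theorem to z |-> h(y) (z - x)^(n+1) - h(z) (y - x)^(n+1)
   treats both signs of y - x at once. *)
Lemma derives_on_norm_le {R : realType} (a b : R) (h h' : R -> R) (x C : R)
    (n : nat) :
  derives_on a b h h' -> x \in `[a, b] -> h x = 0 ->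
  (forall z, z \in `]a, b[ -> `|h' z| <= C * `|z - x| ^+ n) ->
  forall y, y \in `[a, b] -> `|h y| <= C / n.+1%:R * `|y - x| ^+ n.+1.
Proof.
move=> [hcont hder] xab hx0 h'_le y yab.
have [->|yx] := eqVneq y x.
  by rewrite hx0 subrr !normr0 exprS mul0r mulr0.
pose p : {poly R} := ('X - x%:P) ^+ n.+1.
have pE z : p.[z] = (z - x) ^+ n.+1 by rewrite /p !hornerE.
have p'E z : p^`().[z] = n.+1%:R * (z - x) ^+ n.
  by rewrite /p deriv_exp derivXsubC mul1r hornerMn !hornerE mulr_natl.
pose psi z := h y * p.[z] - (y - x) ^+ n.+1 * h z.
have psi_cont : {within `[a, b], continuous psi}.
  move=> z; apply: (@cvgB _ R^o); apply: (@cvgM _ _ _ _ (cst _)).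
  - exact: cvg_cst.
  - exact: continuous_subspaceT (@continuous_horner _ p) z.
  - exact: cvg_cst.
  - exact: hcont.
have psi_der z : z \in `]a, b[ ->
    is_derive z 1 psi (h y * p^`().[z] - (y - x) ^+ n.+1 * h' z).
  move=> /hder hz; apply: is_deriveB.
have rolle u v : u < v -> u \in `[a, b] -> v \in `[a, b] ->
    psi u = 0 -> psi v = 0 -> exists2 c, c \in `]u, v[ &
    h y * p^`().[c] = (y - x) ^+ n.+1 * h' c.
  move=> uv uab vab psiu psiv.
  have sub z : z \in `]u, v[ -> z \in `]a, b[.
    move: uab vab; rewrite !in_itv /= => /andP[au _] /andP[_ vb] /andP[uz zv].
    by rewrite (le_lt_trans au uz) (lt_le_trans zv vb).
  have [|||c cuv psic] := @Rolle R psi u v uv.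
  - by move=> z /sub /psi_der [].
  - apply: continuous_subspaceW psi_cont => z /=.
    move: uab vab; rewrite !in_itv /= => /andP[au _] /andP[_ vb] /andP[uz zv].
    by rewrite (le_trans au uz) (le_trans zv vb).
  - by rewrite psiu psiv.
  exists c => //; apply/eqP; rewrite -subr_eq0; apply/eqP.
  by have /@derive_val <- := psi_der c (sub _ cuv); exact: derive_val.
have psix : psi x = 0 by rewrite /psi hx0 mulr0 pE subrr exprS mul0r mulr0 subr0.
have psiy : psi y = 0 by rewrite /psi pE mulrC subrr.
(* Since Rolle's point [c] differs from [x], the factor [|c - x| ^ n] can be cancelled below. *)
have [c [cab cx psic]] : exists c, [/\ c \in `]a, b[, c != x &
    h y * p^`().[c] = (y - x) ^+ n.+1 * h' c].
  move: xab yab; rewrite !in_itv /= => /andP[ax xb] /andP[ay yb].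
  have [lt_yx|lt_xy|/eqP] := ltgtP y x; last by rewrite (negbTE yx).
  - have [||//|//|c] := rolle y x lt_yx; rewrite ?in_itv /= ?ax ?ay //.
    move=> /andP[yc cx] E; exists c; split=> //; last by rewrite lt_eqF.
    by rewrite in_itv /= (le_lt_trans ay yc) (lt_le_trans cx xb).
  - have [||//|//|c] := rolle x y lt_xy; rewrite ?in_itv /= ?ax ?ay //.
    move=> /andP[xc cy] E; exists c; split=> //; last by rewrite gt_eqF.
    by rewrite in_itv /= (le_lt_trans ax xc) (lt_le_trans cy yb).
have cx_gt0 : 0 < `|c - x| by rewrite normr_gt0 subr_eq0.
have := congr1 Num.norm psic; rewrite p'E !normrM normr_nat !normrX => E.
rewrite mulrAC ler_pdivlMr ?ltr0n // -(ler_pM2r (exprn_gt0 n cx_gt0)).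
rewrite -mulrA E [C * _]mulrC -mulrA ler_wpM2l ?exprn_ge0 //.
exact: h'_le.
Qed.

Lemma derives_on_sub_horner {R : realType} (a b : R) (f f' : R -> R)
    (p : {poly R}) : derives_on a b f f' ->
  derives_on a b (fun z => f z - p.[z]) (fun z => f' z - p^`().[z]).
Proof.
move=> [fcont fder]; split.
  move=> z; apply: (@cvgB _ R^o); first exact: fcont.
  exact: continuous_subspaceT (@continuous_horner _ p) z.
by move=> z /fder fz; exact: is_deriveB.
Qed.

(** The variable is the displacement from [x]; the degree is below [m], so that [g m] controls the
    remainder. *)
Definition taylor_poly {R : realType} (g : nat -> R -> R) (m : nat) (x : R) :
    {poly R} :=
  \poly_(k < m) (g k x / k`!%:R).

(** Induction on [m]: the remainder vanishes at [x], and its derivative is the remainder of order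
    one less for the shifted sequence. [derives_on_norm_le] integrates that bound and supplies the
    next factor of the factorial. *)
Lemma taylor_remainder_le {R : realType} (a b : R) (g : nat -> R -> R) (m : nat)
    (C x y : R) :
  (forall k, derives_on a b (g k) (g k.+1)) ->
  (forall z, z \in `[a, b] -> `|g m z| <= C) ->
  x \in `[a, b] -> y \in `[a, b] ->
  `|g 0%N y - (taylor_poly g m x).[y - x]| <= C / m`!%:R * `|y - x| ^+ m.
Proof.
move=> + + xab; elim: m g y => [|m IHm] g y dg g_le yab.
  rewrite /taylor_poly poly_def big_ord0 horner0 subr0.
  by rewrite divr1 expr0 mulr1; exact: g_le.
pose p := taylor_poly g m.+1 x \Po ('X - x%:P).
have pE z : p.[z] = (taylor_poly g m.+1 x).[z - x].
  by rewrite horner_comp !hornerE.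
have p'E z : p^`().[z] = (taylor_poly (fun k => g k.+1) m x).[z - x].
  rewrite deriv_comp derivXsubC mulr1 horner_comp !hornerE.
  congr _.[_]; apply/polyP => k; rewrite coef_deriv !coef_poly ltnS.
  case: ifP => // _; last by rewrite mul0rn.
  rewrite -[LHS]mulr_natr factS natrM invfM [_^-1 * _]mulrC mulrA divfK //.
rewrite factS natrM invfM mulrCA mulrA -pE.
rewrite [_^-1 * _]mulrC [C / _ / _]mulrAC.
apply: (derives_on_norm_le a b (fun z => g 0%N z - p.[z])
  (fun z => g 1%N z - p^`().[z])) => //.
- exact: derives_on_sub_horner.
- rewrite pE subrr /taylor_poly horner_poly big_ord_recl big1 ?addr0 /=.
    by rewrite expr0 mulr1 divr1 subrr.
  by move=> i _; rewrite expr0n /= mulr0.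
- move=> z zab; rewrite p'E; apply: IHm => //.
  exact: subset_itv_oo_cc zab.
Qed.

(** * A crude Markov inequality at equidistant nodes *)

Lemma bin_le_exp2 (n k : nat) : ('C(n, k) <= 2 ^ n)%N.
Proof.
elim: n k => [|n IHn] [|k]; rewrite ?bin0 ?expn_gt0 // binS expnS mul2n -addnn.
by rewrite leq_add.
Qed.

(** A weak Stirling bound: [n ^ n] is at most the falling factorial [(2n) ^_ n], which is
    ['C(2n, n) * n!]. *)
Lemma expnn_le_fact (n : nat) : (n ^ n <= 4 ^ n * n`!)%N.
Proof.
have le_ffact m : (m <= n)%N -> (n ^ m <= (n + m) ^_ m)%N.
  elim: m => [|m IHm] mn; first by rewrite ffactn0.
  rewrite expnS addnS ffactSS leq_mul ?IHm //; last exact: ltnW.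
  by rewrite (leq_trans (leq_addr m n)) // leqnSn.
rewrite (leq_trans (le_ffact n (leqnn n))) // -bin_ffact leq_mul2r.
by rewrite -[4%N]/(2 ^ 2)%N -expnM mul2n -addnn bin_le_exp2 orbT.
Qed.

(** Weighting the coefficient of degree [k] by [m ^ k], each new factor ['X - r] contributes at most
    [m] through the shift and [m] through [r]. *)
Lemma coef_prod_XsubC_le {R : realType} (I : Type) (s : seq I) (r : I -> R)
    (m : R) (k : nat) : 0 <= m -> (forall i, `|r i| <= m) ->
  `|(\prod_(i <- s) ('X - (r i)%:P))`_k| * m ^+ k <= (2 * m) ^+ size s.
Proof.
move=> m0 r_le; elim: s k => [|i s IHs] k.
  rewrite big_nil coef1 expr0; case: eqVneq => [->|_].
    by rewrite normr1 expr0 mulr1.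
  by rewrite normr0 mul0r ler01.
rewrite big_cons mulrBl coefB coefXM coefCM /= exprS.
apply: (le_trans (ler_wpM2r (exprn_ge0 _ m0) (ler_normB _ _))).
rewrite mulrDl -mulrA mulrDl !mul1r.
have mS : 0 <= (2 * m) ^+ size s by rewrite exprn_ge0 // mulr_ge0.
apply: lerD.
  case: k => [|k] /=; first by rewrite normr0 mul0r mulr_ge0.
  by rewrite exprS mulrCA ler_wpM2l.
rewrite normrM -mulrA; apply: ler_pM => //; exact: mulr_ge0 (exprn_ge0 _ _).
Qed.

(** The denominator of a Lagrange basis polynomial at the nodes 0, ..., n: the factors with [j < i]
    give [i!], those with [j > i] give [(n - i)!]. *)
Lemma prod_natr_dist {R : realType} (n : nat) (i : 'I_n.+1) :
  \prod_(j < n.+1 | j != i) `|i%:R - j%:R| = (i`! * (n - i)`!)%:R :> R.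
Proof.
have prod_fact (m : nat) (F : 'I_m -> R) : (forall j, F j = (j.+1)%:R) ->
    \prod_j F j = m`!%:R.
  move=> FE; rewrite (eq_bigr _ (fun j _ => FE j)) fact_prod natr_prod big_add1.
  by rewrite /= big_mkord.
rewrite -(big_mkord (fun j => j != i :> nat) (fun j => `|i%:R - j%:R|)).
rewrite (big_cat_nat (n := i)) //=; last exact: ltnW.
rewrite [X in _ * X]big_ltn_cond ?ltn_ord // eqxx /= natrM; congr (_ * _).
  rewrite big_mkord (eq_bigl predT); last by move=> j; rewrite /= ltn_eqF.
  rewrite (reindex_inj rev_ord_inj) /=; apply: prod_fact => j.
  by rewrite -natrB ?leq_subr // subKn // normr_nat.
rewrite -[i.+1]add0n big_addn subSS big_mkord.
rewrite (eq_bigl predT); last by move=> j; rewrite /= addnS gtn_eqF // ltnS leq_addl.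
apply: prod_fact => j.
by rewrite distrC -natrB ?addnS ?leqW ?leq_addl // subSn ?leq_addl // addnK normr_nat.
Qed.

(** The difference of the two sides has size at most [n] and vanishes at [n] distinct nodes. *)
Lemma lagrange_interpolation {F : fieldType} (n : nat) (x : 'I_n -> F)
    (p : {poly F}) : injective x -> (size p <= n)%N ->
  p = \sum_i (p.[x i] / \prod_(j | j != i) (x i - x j)) *:
        \prod_(j | j != i) ('X - (x j)%:P).
Proof.
move=> x_inj szp; apply/eqP; rewrite -subr_eq0; apply/eqP.
set q := \sum_i _.
have szB (i : 'I_n) : (size (\prod_(j | j != i) ('X - (x j)%:P))%R <= n)%N.
  rewrite -big_filter size_prod_XsubC size_filter -sum1_count sum1_card.
  by rewrite cardC1 card_ord; case: (n) i => [[]|].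
have szq : (size q <= n)%N.
  by apply: (leq_trans (size_sum _ _ _)); apply/bigmax_leqP => i _;
     apply: leq_trans (size_scale_leq _ _) _.
have szpq : (size (p - q)%R <= n)%N.
  by rewrite (leq_trans (size_polyD _ _)) // size_polyN geq_max szp szq.
apply: contraTeq szpq => /max_poly_roots roots.
have := roots [seq x i | i : 'I_n].
rewrite map_inj_uniq ?enum_uniq // size_map size_enum_ord -ltnNge.
have all_roots : all (root (p - q)) [seq x i | i : 'I_n].
  apply/allP => _ /mapP[i _ ->]; rewrite /root hornerD hornerN subr_eq0; apply/eqP.
  rewrite /q horner_sum (bigD1 i) //= [X in _ + X]big1 => [|j ji].
    rewrite addr0 hornerZ horner_prod -[LHS]mulr1 -mulrA; congr (_ * _).
    rewrite -[X in _ * X](eq_bigr _ (fun j _ => esym (hornerXsubC (x j) (x i)))).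
    rewrite mulVf //.
    by apply/prodf_neq0 => j ji; rewrite subr_eq0 (inj_eq x_inj) eq_sym.
  rewrite hornerZ horner_prod [X in _ * X](bigD1 i) 1?eq_sym //= hornerXsubC subrr.
  by rewrite mul0r mulr0.
exact.
Qed.

(** In Lagrange's formula the inverse denominators are ['C(n, i) / n!]. The binomials sum to
    [2 ^ n], the basis coefficients cost [(2n) ^ n], and [n ^ n / n! <= 4 ^ n]; together this is
    [16 ^ n]. *)
Lemma coef_le_nodes {R : realType} (n k : nat) (p : {poly R}) (B : R) :
  (size p <= n.+1)%N -> (forall i : 'I_n.+1, `|p.[i%:R]| <= B) ->
  `|p`_k| * n%:R ^+ k <= 16 ^+ n * B.
Proof.
move=> szp pB.
have n_inj : injective (fun i : 'I_n.+1 => i%:R : R).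
  by move=> i j /eqP; rewrite eqr_nat => /eqP /val_inj.
have B0 : 0 <= B := le_trans (normr_ge0 _) (pB ord0).
rewrite (lagrange_interpolation n.+1 _ p n_inj szp) coef_sum.
have term (i : 'I_n.+1) :
   `|((p.[i%:R] / \prod_(j < n.+1 | j != i) (i%:R - j%:R)) *:
        \prod_(j < n.+1 | j != i) ('X - (j%:R)%:P))`_k| * n%:R ^+ k <=
   'C(n, i)%:R * (B * ((2 * n%:R) ^+ n / n`!%:R)).
  rewrite coefZ !normrM normfV normr_prod prod_natr_dist -big_filter -!mulrA.
  have sz : size [seq j <- index_enum 'I_n.+1 | j != i] = n.
    by rewrite size_filter -sum1_count sum1_card cardC1 card_ord.
  have := coef_prod_XsubC_le _ [seq j <- index_enum 'I_n.+1 | j != i]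
    (fun j : 'I_n.+1 => j%:R) n%:R k (ler0n _ n).
  rewrite sz => /(_ _) cB.
  have i_le : (i <= n)%N by rewrite -ltnS.
  have -> : (i`! * (n - i)`!)%:R^-1 = 'C(n, i)%:R / n`!%:R :> R.
    rewrite -(bin_fact i_le) [in RHS]natrM [in RHS]invfM mulrA divff ?mul1r //.
    by rewrite pnatr_eq0 -lt0n bin_gt0.
  rewrite mulrCA -!mulrA ler_wpM2l // mulrCA ler_pM ?mulr_ge0 ?invr_ge0 //.
  rewrite mulrC ler_wpM2r ?invr_ge0 //; apply: cB => j.
  by rewrite normr_nat ler_nat -ltnS.
apply: (le_trans (ler_wpM2r (exprn_ge0 _ (ler0n _ _)) (ler_norm_sum _ _ _))).
rewrite mulr_suml (le_trans (ler_sum _ (fun i _ => term i))) //.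
rewrite -mulr_suml -natr_sum (_ : \sum_(i < n.+1) 'C(n, i) = 2 ^ n)%N; last first.
  rewrite -[2%N]/(1 + 1)%N expnDn; apply: eq_bigr => i _.
  by rewrite !exp1n !muln1.
rewrite mulrCA [leRHS]mulrC ler_wpM2l // mulrA.
rewrite ler_pdivrMr ?ltr0n ?fact_gt0 // exprMn -!natrX -!natrM ler_nat.
rewrite mulnA -expnMn (leq_trans (leq_mul (leqnn _) (expnn_le_fact n))) //.
by rewrite mulnA -expnMn.
Qed.

(** * The Gorny-type estimate for intermediate derivatives *)

Lemma fact_le_expn (n k : nat) : (k <= n -> k`! <= n ^ k)%N.
Proof.
elim: k => // k IHk kn; rewrite factS expnS leq_mul // IHk //; exact: ltnW.
Qed.

(** From any point of the interval, at least half of its length is available to the right or to the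
    left; [e] is the sign of that direction. *)
Lemma itv_step {R : realType} (a b x l : R) :
  x \in `[a, b] -> 0 <= l -> 2 * l <= b - a ->
  exists2 e : R, `|e| = 1 &
    forall u, 0 <= u -> u <= l -> x + e * u \in `[a, b].
Proof.
rewrite in_itv /= => /andP[ax xb] l0 lab.
have [xlb|bxl] := lerP (x + l) b.
  exists 1; rewrite ?normr1 // => u u0 ul; rewrite in_itv /=.
  by apply/andP; split; lra.
exists (-1); rewrite ?normrN1 // => u u0 ul; rewrite in_itv /=.
by apply/andP; split; lra.
Qed.

Lemma derives_on_interpolation {R : realType} (a b : R) (g : nat -> R -> R)
    (n k : nat) (t B0 B1 x : R) :
  (forall k, derives_on a b (g k) (g k.+1)) ->
  0 < t -> 2 * (n%:R * t) <= b - a ->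
  (forall z, z \in `[a, b] -> `|g 0%N z| <= B0) ->
  (forall z, z \in `[a, b] -> `|g n.+1 z| <= B1) ->
  x \in `[a, b] -> (k <= n)%N ->
  t ^+ k * `|g k x| <= 16 ^+ n * (B0 + (4 * t) ^+ n.+1 * B1).
Proof.
move=> dg t0 nt_le g0_le gn_le xab kn.
have [|e e1 step] := itv_step a b x (n%:R * t) xab _ nt_le.
  by rewrite mulr_ge0 // ltW.
pose s := e * t.
have s_norm : `|s| = t by rewrite normrM e1 mul1r gtr0_norm.
(* The Taylor polynomial rescaled by the signed step [s]: the nodes [x + s * i] become the integers
   [i]. *)
pose q : {poly R} := \poly_(j < n.+1) (g j x / j`!%:R * s ^+ j).
have B1_ge0 : 0 <= B1 := le_trans (normr_ge0 _) (gn_le x xab).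
have q_node (i : 'I_n.+1) : `|q.[i%:R]| <= B0 + (4 * t) ^+ n.+1 * B1.
  have node : x + s * i%:R \in `[a, b].
    rewrite -mulrA; apply: step; first by rewrite mulr_ge0 // ltW.
    by rewrite [t * _]mulrC ler_wpM2r ?(ltW t0) // ler_nat -ltnS.
  have := taylor_remainder_le a b g n.+1 B1 x _ dg gn_le xab node.
  have -> : (taylor_poly g n.+1 x).[x + s * i%:R - x] = q.[i%:R].
    rewrite addrC addKr !horner_poly; apply: eq_bigr => j _.
    by rewrite exprMn mulrA.
  rewrite distrC => rem.
  rewrite -[q.[_]](subrK (g 0%N (x + s * i%:R))) addrC.
  apply: (le_trans (ler_normD _ _)); apply: lerD; first exact: g0_le.
  apply: (le_trans rem); rewrite addrC addKr normrM s_norm normr_nat.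
  (* Here [i ^ (n+1) <= (n+1) ^ (n+1) <= 4 ^ (n+1) * (n+1)!] absorbs the factorial of the
     remainder. *)
  rewrite mulrAC ler_pdivrMr ?ltr0n ?fact_gt0 // exprMn.
  have -> : (4 * t) ^+ n.+1 * B1 * n.+1`!%:R =
      B1 * (t ^+ n.+1 * (4 ^+ n.+1 * n.+1`!%:R)) by rewrite exprMn; ring.
  rewrite !ler_wpM2l ?exprn_ge0 ?(ltW t0) // -!natrX -natrM ler_nat.
  by rewrite (leq_trans _ (expnn_le_fact n.+1)) // leq_exp2r // ltnW.
have := coef_le_nodes n k q _ (size_poly _ _) q_node.
apply: le_trans; rewrite coef_poly ltnS kn !normrM normrX s_norm.
rewrite normfV normr_nat.
have -> : `|g k x| / k`!%:R * t ^+ k * n%:R ^+ k =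
    t ^+ k * `|g k x| * (n%:R ^+ k / k`!%:R) by ring.
rewrite ler_peMr ?mulr_ge0 ?exprn_ge0 ?(ltW t0) //.
by rewrite ler_pdivlMr ?ltr0n ?fact_gt0 // mul1r -natrX ler_nat fact_le_expn.
Qed.

Lemma exprn_le_exprn {R : realDomainType} (u A : R) (i j : nat) :
  0 <= u -> u <= A -> 1 <= A -> (i <= j)%N -> u ^+ i <= A ^+ j.
Proof.
move=> u0 uA A1 ij; apply: (le_trans (lerXn2r i _ _ uA)).
- by rewrite nnegrE.
- by rewrite nnegrE (le_trans u0).
- exact: ler_weXn2l.
Qed.

(** The interpolation estimate is applied to [g p] with step [t = tau / mu]. The number [A]
    majorizes all constants, so it remains to count exponents. *)
Lemma interpolated_growth {R : realType} (a b : R) (g : nat -> R -> R)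
    (p n q : nat) (mu tau K nu A x : R) :
  (forall k, derives_on a b (g k) (g k.+1)) ->
  (p <= n)%N -> (n < q)%N ->
  0 < mu -> 0 < tau -> 0 <= K -> 0 <= nu ->
  2 * (q%:R * tau) <= (b - a) * mu ->
  (forall z, z \in `[a, b] -> `|g p z| <= K ^+ p.+1 * mu ^+ p) ->
  (forall z, z \in `[a, b] -> `|g q z| <= K ^+ q.+1 * (nu * mu) ^+ q) ->
  16 <= A -> K <= A -> nu <= A -> tau <= A -> tau^-1 <= A ->
  x \in `[a, b] -> `|g n x| <= A ^+ (5 * q).+2 * mu ^+ n.
Proof.
move=> dg pn nq mu0 tau0 K0 nu0 tau_le gp gq A16 KA nuA tauA tauVA xab.
have [k nE] : exists k, n = (p + k)%N by exists (n - p)%N; rewrite subnKC.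
(* The successor reflects [n < q]: the Taylor polynomial has degree [k + l], and its remainder
   involves [g q]. *)
have [l qE] : exists l, q = (p + (k + l).+1)%N.
  by exists (q - n.+1)%N; rewrite addnS addnA -nE -addSn subnKC.
have [t t0 tauE] : exists2 t, 0 < t & tau = t * mu.
  by exists (tau / mu); [exact: divr_gt0|rewrite divfK // gt_eqF].
have A1 : 1 <= A by lra.
have A0 : 0 <= A by lra.
have kq : (k + l <= q)%N by rewrite qE addnS leqW ?leq_addl.
have := derives_on_interpolation a b (fun j => g (p + j)%N) (k + l) k t
  (K ^+ p.+1 * mu ^+ p) (K ^+ q.+1 * (nu * mu) ^+ q) x.
rewrite addn0 -qE -nE => /(_ _ t0 _ gp gq xab (leq_addr _ _)) le_g.
have {}le_g : t ^+ k * `|g n x| <=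
    16 ^+ (k + l) * (K ^+ p.+1 * mu ^+ p +
      (4 * t) ^+ (k + l).+1 * (K ^+ q.+1 * (nu * mu) ^+ q)).
  apply: le_g => [j|]; first by rewrite addnS; exact: dg.
  rewrite -(ler_pM2r mu0) (le_trans _ tau_le) // -!mulrA -tauE.
  by rewrite ler_wpM2l // ler_wpM2r ?(ltW tau0) // ler_nat kq.
have t_k : 0 < t ^+ k by rewrite exprn_gt0.
rewrite -(ler_pM2l t_k); apply: (le_trans le_g).
(* Since [tau = t * mu], both terms contain [t ^ k * mu ^ n]; the cofactors are [tau ^ (-k)] and
   [tau ^ (l+1)] times constants. *)
have -> : K ^+ p.+1 * mu ^+ p +
      (4 * t) ^+ (k + l).+1 * (K ^+ q.+1 * (nu * mu) ^+ q) =
   (t ^+ k * mu ^+ n) * (K ^+ p.+1 * tau^-1 ^+ k +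
      4 ^+ (k + l).+1 * tau ^+ l.+1 * K ^+ q.+1 * nu ^+ q).
  have -> : mu ^+ p = t ^+ k * mu ^+ n * tau^-1 ^+ k.
    rewrite nE exprD mulrCA -exprMn -tauE -mulrA -exprMn mulfV ?gt_eqF //.
    by rewrite expr1n mulr1.
  have -> : (4 * t) ^+ (k + l).+1 * (K ^+ q.+1 * (nu * mu) ^+ q) =
    4 ^+ (k + l).+1 * (t ^+ k * mu ^+ (p + k)%N) * tau ^+ l.+1 * K ^+ q.+1 * nu ^+ q.
    rewrite tauE !exprMn [in mu ^+ q]qE -addnS addnA !(exprD _ _ l.+1).
    by rewrite exprD; ring.
  by rewrite nE; ring.
rewrite mulrCA -[leLHS]mulrA (ler_wpM2l (ltW t_k)) // mulrC.
rewrite ler_wpM2r ?exprn_ge0 ?(ltW mu0) // -!mulrA.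
have -> : ((5 * q).+2 = q + (4 * q).+2)%N by rewrite !addnS -mulSn.
have powA (u : R) (i j : nat) :
    0 <= u -> u <= A -> (i <= j)%N -> u ^+ i <= A ^+ j.
  by move=> u0 uA; exact: exprn_le_exprn.
have powM (u v : R) (i j : nat) : 0 <= u <= A ^+ i -> 0 <= v <= A ^+ j ->
    0 <= u * v <= A ^+ (i + j).
  move=> /andP[u0 uA] /andP[v0 vA].
  by rewrite mulr_ge0 //= exprD ler_pM.
have pow_itv (u : R) (i j : nat) : 0 <= u -> u <= A -> (i <= j)%N ->
    0 <= u ^+ i <= A ^+ j.
  by move=> u0 uA ij; rewrite exprn_ge0 //= powA.
have tau0' := ltW tau0.
have tauV0 : 0 <= tau^-1 by rewrite invr_ge0.
have le4A : 4 <= A by lra.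
have pq : (p < q)%N := leq_ltn_trans pn nq.
have [kq' lq] : (k <= q)%N /\ ((k + l).+1 <= q)%N.
  by rewrite qE leq_addl -addnS addnCA leq_addr.
have lq' : (l < q)%N by apply: leq_trans lq; rewrite ltnS leq_addl.
have /andP[_ le1] := powM _ _ _ _ (pow_itv _ p.+1 q K0 KA pq)
  (pow_itv _ k q tauV0 tauVA kq').
have /andP[_ le2] := powM _ _ _ _ (pow_itv _ (k + l).+1 q (ler0n _ 4) le4A lq)
  (powM _ _ _ _ (pow_itv _ l.+1 q tau0' tauA lq')
    (powM _ _ _ _ (pow_itv _ q.+1 q.+1 K0 KA (leqnn _))
      (pow_itv _ q q nu0 nuA (leqnn _)))).
rewrite !(exprD A q) ler_pM ?exprn_ge0 //.
- by rewrite addr_ge0 ?mulr_ge0 ?exprn_ge0.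
- exact: powA.
(* The two terms are at most [A ^ (2q)] and [A ^ (4q+1)]; one more factor [A >= 2] absorbs their
   sum. *)
rewrite [A ^+ _.+2]exprS; apply: (@le_trans _ _ (2 * A ^+ (4 * q).+1)); last first.
  by rewrite ler_wpM2r ?exprn_ge0 //; lra.
rewrite mulr_natl mulr2n lerD //.
  by rewrite (le_trans le1) // ler_weXn2l // addnn -mul2n leqW // leq_mul2r orbT.
rewrite (le_trans le2) // ler_weXn2l //.
by rewrite !addSn !addnS ltnS !mulSn addn0.
Qed.

(** * Roots of the weights, and the bound for all derivatives of [f] *)

Lemma powR_natr_div {R : realType} (x : R) (j n : nat) :
  x `^ (j%:R / n%:R) = (x `^ n%:R^-1) ^+ j.
Proof. by rewrite mulrC powRrM powR_mulrn ?powR_ge0. Qed.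

Lemma powR_invr_natK {R : realType} (x : R) (n : nat) :
  0 <= x -> (0 < n)%N -> (x `^ n%:R^-1) ^+ n = x.
Proof.
by move=> x0 n0; rewrite -powR_natr_div divff ?powRr1 // pnatr_eq0 -lt0n.
Qed.

(** The first index with [d] above [n] is not 0, as [d 0 <= n]; its predecessor is the required
    [i]. *)
Lemma cvgn_infty_between (d : nat -> nat) (n : nat) :
  d n @[n --> \oo] --> \oo -> (d 0 <= n)%N ->
  exists i, (d i <= n < d i.+1)%N.
Proof.
move=> /cvgnyPge/(_ n.+1) [N _ /(_ N (leqnn N)) nN] d0.
have ex : exists i, (n < d i)%N by exists N.
case: (ex_minnP ex) => -[|i] ni min_i; first by move: ni; rewrite ltnNge d0.
exists i; rewrite ni andbT leqNgt; apply/negP => /min_i.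
by rewrite ltnn.
Qed.

Theorem theorem1 (R : realType) (a b : R) (hab : a < b)
    (M : nat -> R) (hM0 : M 0%N = 1) (hMpos : forall n : nat, 0 < M n)
    (f : R -> R) (hf : smooth_within `[a, b]%classic f)
    (d : nat -> nat) (hdpos : forall n : nat, (0 < d n)%N)
    (hdincr : forall m n : nat, (m <= n)%N -> (d m <= d n)%N)
    (hddiv : d n @[n --> \oo] --> \oo)
    (F : nat -> R)
    (hF : forall n : nat,
       is_maximum [set `|deriven_within `[a, b]%classic n f x|
                     | x in `[a, b]%classic] (F n))
    (h1 : forall j l k : nat, (j < l)%N -> (l < k)%N ->
       M l <= M j `^ ((k%:R - l%:R) / (k%:R - j%:R))
              * M k `^ ((l%:R - j%:R) / (k%:R - j%:R)))
    (h2 : exists m0 : nat, forall i j k : nat,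
       (m0 < i)%N -> (m0 < k)%N -> (i < j)%N -> j%:R / i%:R < k%:R :> R ->
       M j <= M k `^ (j%:R / k%:R) * M i `^ (j%:R / i%:R))
    (h3 : exists2 c : R, 0 < c & forall n : nat, c ^+ n * n%:R ^+ n <= M n)
    (h4 : exists2 K : R, 0 < K &
       forall n : nat, F (d n) <= K ^+ (d n).+1 * M (d n))
    (h5 : exists2 c0 : R, 0 < c0 &
       forall n : nat, (d n.+1)%:R / (d n)%:R <= c0) :
  denjoy_carleman M a b f.
Proof.
case: h2 => m0 h2; case: h3 => c c_gt0 h3; case: h4 => K K_gt0 h4.
case: h5 => c0 c0_gt0 h5; split=> //.
pose g n := deriven_within `[a, b]%classic n f.
have dg k : derives_on a b (g k) (g k.+1) by exact/derives_on_derive_within/hf.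
have g_le n x : x \in `[a, b] -> `|g n x| <= F n.
  by move=> xab; apply: (hF n).2; exists x.
have F_ge0 n : 0 <= F n.
  by apply: le_trans (g_le n a _); rewrite ?normr_ge0 // in_itv /= lexx ltW.
(* [kappa] exceeds [m0], to be admissible in [h2], and [c0], to exceed every ratio [d i.+1 / n] that
   occurs. *)
pose kappa := (maxn m0 (Num.bound c0)).+1.
pose mu n := M n `^ n%:R^-1.
have muE n : (0 < n)%N -> mu n ^+ n = M n.
  by move=> n0; exact/powR_invr_natK/n0/ltW.
have mu_gt0 n : 0 < mu n by exact: powR_gt0.
(* Chosen so that [2 * c0 * n * tau = (b - a) * c * n], which is at most [(b - a) * mu n]. *)
pose tau := (b - a) * c / (2 * c0).
have tau_gt0 : 0 < tau by rewrite divr_gt0 ?mulr_gt0 ?subr_gt0.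
pose A := 16 + K + mu kappa + tau + tau^-1.
have tauV_gt0 : 0 < tau^-1 by rewrite invr_gt0.
have nu_gt0 := mu_gt0 kappa.
have [A16 KA nuA] : [/\ 16 <= A, K <= A & mu kappa <= A].
  by rewrite /A; split; lra.
have [tauA tauVA] : tau <= A /\ tau^-1 <= A by rewrite /A; split; lra.
have A1 : 1 <= A by lra.
have lt_kappa : c0 < kappa%:R.
  rewrite (lt_le_trans (archi_boundP (ltW c0_gt0))) // ler_nat.
  by rewrite leqW // leq_maxr.
have large n x : (m0 < n)%N -> (d 0 <= n)%N -> x \in `[a, b] ->
    `|g n x| <= (A ^+ (5 * kappa).+2) ^+ n.+1 * M n.
  move=> m0n d0n xab.
  have n_gt0 : (0 < n)%N := leq_ltn_trans (leq0n _) m0n.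
  have [i /andP[pn nq]] := cvgn_infty_between d n hddiv d0n.
  have n_gt0R : 0 < n%:R :> R by rewrite ltr0n.
  have q_le : (d i.+1)%:R <= c0 * n%:R.
    have := h5 i; rewrite ler_pdivrMr ?ltr0n // => /le_trans; apply.
    by rewrite ler_wpM2l ?ler_nat // ltW.
  have qn_kappa : (d i.+1 <= kappa * n)%N.
    rewrite -(ler_nat R) natrM (le_trans q_le) // ler_wpM2r //.
    exact: ltW.
  have Mp_le : M (d i) <= mu n ^+ d i.
    (* Log-convexity is applied to [0 < d i < n]; its strict inequalities make [d i = n] a separate
       case. *)
    have [->|pn'] := eqVneq (d i) n; first by rewrite muE.
    have := h1 0%N (d i) n (hdpos i); rewrite ltn_neqAle pn' pn => /(_ isT).
    by rewrite hM0 powR1 mul1r !subr0 powR_natr_div.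
  have Mq_le : M (d i.+1) <= (mu kappa * mu n) ^+ d i.+1.
    rewrite exprMn -!powR_natr_div; apply: h2 => //.
      by rewrite ltnS leq_maxl.
    by rewrite ltr_pdivrMr // (le_lt_trans q_le) // ltr_pM2r.
  have mu_ge : c * n%:R <= mu n.
    rewrite -(@ler_pXn2r _ n) ?nnegrE ?mulr_ge0 ?(ltW c_gt0) ?(ltW (mu_gt0 n)) //.
    by rewrite muE // exprMn.
  have step_le : 2 * ((d i.+1)%:R * tau) <= (b - a) * mu n.
    apply: (@le_trans _ _ (2 * (c0 * n%:R * tau))).
      by rewrite ler_wpM2l // ler_wpM2r // ltW.
    have -> : 2 * (c0 * n%:R * tau) = (b - a) * (c * n%:R).
      by rewrite /tau; field; rewrite gt_eqF.
    by rewrite ler_wpM2l // subr_ge0 ltW.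
  apply: le_trans (interpolated_growth a b g (d i) n (d i.+1) (mu n) tau K
    (mu kappa) A x dg pn nq (mu_gt0 n) tau_gt0 (ltW K_gt0) (ltW nu_gt0)
    step_le _ _ A16 KA nuA tauA tauVA xab) _.
  - move=> z zab; rewrite (le_trans (g_le _ z zab)) // (le_trans (h4 i)) //.
    by rewrite ler_wpM2l // exprn_ge0 // ltW.
  - move=> z zab; rewrite (le_trans (g_le _ z zab)) // (le_trans (h4 i.+1)) //.
    by rewrite ler_wpM2l // exprn_ge0 // ltW.
  (* From [q <= kappa * n] for [q = d i.+1], the exponent [5q + 2] is at most
     [(5 kappa + 2) * (n + 1)]. *)
  rewrite muE // ler_wpM2r ?(ltW (hMpos n)) // -exprM ler_weXn2l //.
  rewrite mulnS -addn2 addnC leq_add //.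
  rewrite (leq_trans (leq_mul (leqnn 5) qn_kappa)) // mulnA leq_mul //.
  by rewrite leqW // leqW.
pose N := maxn m0 (d 0%N).
pose D := A ^+ (5 * kappa).+2.
(* The finitely many [n <= N] not covered by [large] are absorbed by adding their ratios [F n / M n]
   to the constant. *)
pose S := \sum_(n < N.+1) F n / M n.
have D_ge1 : 1 <= D by exact: exprn_ege1.
have ratio_ge0 n : 0 <= F n / M n by rewrite divr_ge0 // ltW.
have S_ge0 : 0 <= S by exact: sumr_ge0.
have DS_ge1 : 1 <= D + S by rewrite (le_trans D_ge1) // lerDl.
exists (D + S); first exact: lt_le_trans DS_ge1.
move=> x n xab; have [nN|Nn] := leqP n N; last first.
  move: Nn; rewrite gtn_max => /andP[m0n d0n].
  rewrite (le_trans (large n x m0n (ltnW d0n) xab)) // ler_wpM2r ?(ltW (hMpos n)) //.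
  by apply: exprn_le_exprn => //; rewrite ?lerDl // (le_trans ler01).
rewrite (le_trans (g_le n x xab)) // -ler_pdivrMr //.
(* As [D + S >= 1], its power of exponent [n + 1] dominates [D + S], which dominates the single
   ratio [F n / M n]. *)
rewrite (@le_trans _ _ (D + S)) ?ler_eXnr //.
have nN1 : (n < N.+1)%N by rewrite ltnS.
rewrite /S (bigD1 (Ordinal nN1)) //= addrCA lerDl addr_ge0 ?sumr_ge0 //.
exact: le_trans D_ge1.
Qed.
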